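(* Let $\pi:\hat{\mathsf{G}}\to\mathbb{Z}_2$ be a Real structure on a finite group $\mathsf{G}$ and let $\hat\alpha,\hat\beta\in C^{n+\pi}(B\hat{\mathsf{G}})$. The cochain operations $\{\wp_N\}_{N\ge0}$ satisfy: (i) $\wp_0(\hat\alpha)=1$ and $\wp_1(\hat\alpha)=\hat\alpha$. (ii) $\wp_M(\hat\alpha)\boxtimes\wp_N(\hat\alpha)=\iota^*\wp_{M+N}(\hat\alpha)$, where $\iota^*$ is pullback along the inclusion $\iota:\widehat{\mathsf{G}\wr\Sigma_M}\times_{\mathbb{Z}_2}\widehat{\mathsf{G}\wr\Sigma_N}\to\widehat{\mathsf{G}\wr\Sigma_{M+N}}$. (iii) $\wp_M(\wp_N(\hat\alpha))=\iota^*\wp_{MN}(\hat\alpha)$, where $\iota^*$ is pullback along the inclusion $\iota:\widehat{\mathsf{G}\wr(\Sigma_N\wr\Sigma_M)}\to\widehat{\mathsf{G}\wr\Sigma_{MN}}$. (iv) $\wp_N(\hat\alpha\hat\beta)=\iota^*(\wp_N(\hat\alpha)\boxtimes\wp_N(\hat\beta))$, where $\iota^*$ is pullback along the inclusion $\iota:\widehat{\mathsf{G}\wr\Sigma_N}\to\widehat{\mathsf{G}\wr(\Sigma_N\times\Sigma_N)}$.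
   Context: $\mathbb{Z}_2=\{\pm1\}$; $\mathbb{T}$ = unit complex numbers. A Real structure on $\mathsf{G}$ is a surjection $\pi:\hat{\mathsf{G}}\to\mathbb{Z}_2$ with kernel $\mathsf{G}$; here $\hat{\mathsf{G}}$ is finite. $C^{n+\pi}(B\hat{\mathsf{G}})$ is the multiplicative group of normalized functions $\hat\alpha([a_1|\cdots|a_n])$, $a_i\in\hat{\mathsf{G}}$, with values in $\mathbb{T}$. $\mathsf{G}\wr\Sigma_N=\mathsf{G}^N\times\Sigma_N$ with $(\underline g;\sigma)(\underline h;\tau)=(g_1h_{\sigma^{-1}(1)},\dots,g_Nh_{\sigma^{-1}(N)};\sigma\tau)$; $\widehat{\mathsf{G}\wr\Sigma_N}=\{(\underline g;\sigma)\in\hat{\mathsf{G}}\wr\Sigma_N\mid\pi(g_i)=\pi(g_j)\ \forall i,j\}$ with $\pi(\underline g;\sigma)=\pi(g_i)$; the same definition is used with $\Sigma_N$ replaced by a subgroup. For $N\ge1$, $\wp_N:C^{n+\pi}(B\hat{\mathsf{G}})\to C^{n+\pi}(B\widehat{\mathsf{G}\wr\Sigma_N})$ is $$\wp_N(\hat\alpha)([a_1|\cdots|a_n])=\prod_{j=1}^N\hat\alpha([(g_1)_j\,|\,(g_2)_{\sigma_1^{-1}(j)}\,|\,(g_3)_{(\sigma_1\sigma_2)^{-1}(j)}\,|\cdots|\,(g_n)_{(\sigma_1\cdots\sigma_{n-1})^{-1}(j)}]),\qquad a_i=(\underline{g_i};\sigma_i),$$ where $(g_i)_j$ is the $j$-th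 entry of $\underline{g_i}$, and $\wp_0(\hat\alpha)=1$ by convention. $\boxtimes$ is external pointwise product: for cochains $u,v$ on graded groups $\hat{\mathsf{K}},\hat{\mathsf{L}}$, $(u\boxtimes v)([(a_1,b_1)|\cdots|(a_n,b_n)])=u([a_1|\cdots|a_n])v([b_1|\cdots|b_n])$ on $\hat{\mathsf{K}}\times_{\mathbb{Z}_2}\hat{\mathsf{L}}$; $\hat\alpha\hat\beta$ in (iv) is the pointwise product on $\hat{\mathsf{G}}$. In (ii), $\iota((\underline g;\sigma),(\underline h;\tau))=(\underline g,\underline h;(\sigma,\tau))$ with $\Sigma_M\times\Sigma_N\le\Sigma_{M+N}$ block-wise. In (iii), $\widehat{\mathsf{G}\wr(\Sigma_N\wr\Sigma_M)}$ is the Real structure on $\mathsf{G}\wr(\Sigma_N\wr\Sigma_M)=(\mathsf{G}\wr\Sigma_N)\wr\Sigma_M$; $\Sigma_N\wr\Sigma_M\le\Sigma_{MN}$ acts on $\{j_k\mid1\le j\le M,1\le k\le N\}$ by $(\underline\tau;\sigma)\cdot j_k=\sigma(j)_{\tau_{\sigma(j)}(k)}$ and $\iota((\underline{g_1};\tau_1),\dots,(\underline{g_M};\tau_M);\sigma)=(\underline{g_1},\dots,\underline{g_M};(\underline\tau;\sigma))$. In (iv), $\widehat{\mathsf{G}\wr(\Sigma_N\times\Sigma_N)}=\widehat{\mathsf{G}\wr\Sigma_N}\times_{\mathbb{Z}_2}\widehat{\mathsf{G}\wr\Sigma_N}$ and $\iota$ is the diagonal. *)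

(* Defs.v *)
From HB Require Import structures.
From mathcomp Require Import all_boot all_order all_fingroup all_algebra.
From mathcomp Require Import reals complex.

Set Implicit Arguments.
Unset Strict Implicit.
Unset Printing Implicit Defensive.

Import GRing.Theory Num.Theory.
Local Open Scope group_scope.

Definition Z2 : predArgType := seq_sub [:: 1%R; (-1)%R : int].
HB.instance Definition _ := Finite.on Z2.

Lemma Z2_mul_subproof (x y : Z2) :
  (val x * val y)%R \in [:: 1%R; (-1)%R : int].
Proof.
by case: x y => x hx [y hy] /=; move: hx hy; rewrite !inE;
   case/orP=> /eqP-> /orP[] /eqP->.
Qed.

Definition Z2_mul (x y : Z2) : Z2 := SeqSub (Z2_mul_subproof x y).
Definition Z2_one : Z2 := SeqSub (mem_head 1%R [:: (-1)%R : int]).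

Fact Z2_mulA : associative Z2_mul.
Proof. by move=> x y z; apply: val_inj; rewrite /= mulrA. Qed.
Fact Z2_mul1 : left_id Z2_one Z2_mul.
Proof. by move=> x; apply: val_inj; rewrite /= mul1r. Qed.
Fact Z2_mulV : left_inverse Z2_one id Z2_mul.
Proof.
case=> x hx; apply: val_inj => /=.
by move: hx; rewrite !inE => /orP[] /eqP->.
Qed.
HB.instance Definition _ := Finite_isGroup.Build Z2 Z2_mulA Z2_mul1 Z2_mulV.

Record gradedGroup := GradedGroup {
  graded_sort :> finGroupType;
  deg : {morphism [set: graded_sort] >-> Z2}
}.

Lemma degM (K : gradedGroup) (x y : K) : deg K (x * y) = deg K x * deg K y.
Proof. by rewrite morphM ?inE. Qed.

Lemma deg1 (K : gradedGroup) : deg K 1 = 1.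
Proof. exact: morph1. Qed.

(* [Ghat], with the morphism [deg Ghat] in the role of pi, is a Real structure
   on the finite group [G]. *)
Definition RealStructure (Ghat : gradedGroup) (G : {group Ghat}) : Prop :=
  deg Ghat @* [set: Ghat] = [set: Z2] /\ 'ker (deg Ghat) = G.
Arguments RealStructure : clear implicits.

Record gradedHom (K L : gradedGroup) := GradedHom {
  graded_fun :> K -> L;
  graded_funM : {morph graded_fun : x y / x * y};
  graded_fun_deg : forall x, deg L (graded_fun x) = deg K x
}.

Lemma graded_fun1 (K L : gradedGroup) (f : gradedHom K L) : f 1 = 1.
Proof. by apply: (mulgI (f 1)); rewrite -graded_funM !mulg1. Qed.

Section FibreProduct.
Variables K L : gradedGroup.

Definition fibre_set : {set K * L} := [set x | deg K x.1 == deg L x.2].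

Fact fibre_group_set : group_set fibre_set.
Proof.
apply/group_setP; split; first by rewrite inE !deg1.
by move=> x y; rewrite !inE !degM => /eqP-> /eqP->.
Qed.
Canonical fibre_group := Group fibre_group_set.

Definition fibre_deg (x : subg_of fibre_group) : Z2 := deg K (sgval x).1.

Fact fibre_degM : {in [set: subg_of fibre_group] &, {morph fibre_deg : x y / x * y}}.
Proof. by move=> x y _ _; rewrite /fibre_deg degM. Qed.

Definition fibreProduct : gradedGroup := GradedGroup (Morphism fibre_degM).

Definition fibre_fst (x : fibreProduct) : K := (sgval x).1.
Definition fibre_snd (x : fibreProduct) : L := (sgval x).2.

Lemma fibreP (x : fibreProduct) : deg K (fibre_fst x) = deg L (fibre_snd x).
Proof. by have:= subgP x; rewrite inE => /eqP. Qed.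

End FibreProduct.

(* The product of 'S_N in the library is diagrammatic, (s * t) x = t (s x);
   here permutations are composed as functions. *)
Definition perm_comp (T : finType) (s t : {perm T}) : {perm T} := t * s.

Lemma perm_compE (T : finType) (s t : {perm T}) x : perm_comp s t x = s (t x).
Proof. by rewrite permM. Qed.

Section Wreath.
Variables (K : finGroupType) (N : nat).

Record wreath := Wreath {
  wreath_base : {ffun 'I_N -> K};
  wreath_perm : {perm 'I_N}
}.

Definition pair_of_wreath (x : wreath) := (wreath_base x, wreath_perm x).
Definition wreath_of_pair (p : {ffun 'I_N -> K} * {perm 'I_N}) :=
  Wreath p.1 p.2.
Fact pair_of_wreathK : cancel pair_of_wreath wreath_of_pair.
Proof. by case. Qed.
HB.instance Definition _ := Finite.copy wreath (can_type pair_of_wreathK).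

Definition wreath_mul (x y : wreath) : wreath :=
  Wreath [ffun i => wreath_base x i * wreath_base y ((wreath_perm x)^-1 i)]
         (perm_comp (wreath_perm x) (wreath_perm y)).
Definition wreath_one : wreath := Wreath [ffun=> 1] 1.
Definition wreath_inv (x : wreath) : wreath :=
  Wreath [ffun i => (wreath_base x (wreath_perm x i))^-1] (wreath_perm x)^-1.

Fact wreath_mulA : associative wreath_mul.
Proof.
move=> [f s] [g t] [h u]; rewrite /wreath_mul /perm_comp /= !mulgA; congr Wreath.
by apply/ffunP=> i; rewrite !ffunE mulgA invMg permM.
Qed.
Fact wreath_mul1 : left_id wreath_one wreath_mul.
Proof.
move=> [f s]; rewrite /wreath_mul /perm_comp /= mulg1; congr Wreath.
by apply/ffunP=> i; rewrite !ffunE mul1g invg1 perm1.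
Qed.
Fact wreath_mulV : left_inverse wreath_one wreath_inv wreath_mul.
Proof.
move=> [f s]; rewrite /wreath_mul /perm_comp /= mulgV; congr Wreath.
by apply/ffunP=> i; rewrite !ffunE invgK mulVg.
Qed.
HB.instance Definition _ :=
  Finite_isGroup.Build wreath wreath_mulA wreath_mul1 wreath_mulV.

End Wreath.

Section GradedWreath.
Variables (K : gradedGroup) (N : nat).

(* For K = Ghat and N >= 1, this is the set underlying the Real structure on
   G wr Sigma_N. *)
Definition equideg : {set wreath K N} :=
  [set x | [forall i, forall j,
             deg K (wreath_base x i) == deg K (wreath_base x j)]].

(* An element is an element x of [equideg] together with its degree, which is
   the common degree of the entries of x.  For N >= 1 the degree is determined
   by x, see [hwreath_equideg], [hwreath_val_inj] and [deg_hwreath]. For N = 0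
   there are no entries and any degree is allowed, so that the group is Z2, the
   Real structure on the trivial group (the fibre product over Z2 of the empty
   family), see [deg_hwreath_surj]. *)
Definition hwreath_set : {set wreath K N * Z2} :=
  [set x | (x.1 \in equideg) && [forall i, deg K (wreath_base x.1 i) == x.2]].

Lemma hwreath_setP (x : wreath K N * Z2) :
  reflect (forall i, deg K (wreath_base x.1 i) = x.2) (x \in hwreath_set).
Proof.
apply: (iffP idP) => [|hx]; rewrite !inE.
  by case/andP=> _ /forallP hx i; apply/eqP.
apply/andP; split; last by apply/forallP => i; rewrite hx.
by apply/forallP => i; apply/forallP => j; rewrite !hx.
Qed.

Fact hwreath_group_set : group_set hwreath_set.
Proof.
apply/group_setP; split.
  by apply/hwreath_setP => i; rewrite /= ffunE deg1.
move=> x y /hwreath_setP hx /hwreath_setP hy; apply/hwreath_setP => i.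
by rewrite /= ffunE degM hx hy.
Qed.
Canonical hwreath_group := Group hwreath_group_set.

Definition hwreath_deg (x : subg_of hwreath_group) : Z2 := (sgval x).2.

Fact hwreath_degM :
  {in [set: subg_of hwreath_group] &, {morph hwreath_deg : x y / x * y}}.
Proof. by []. Qed.

Definition hwreath : gradedGroup := GradedGroup (Morphism hwreath_degM).

Definition hbase (x : hwreath) : 'I_N -> K := wreath_base (sgval x).1.
Definition hperm (x : hwreath) : {perm 'I_N} := wreath_perm (sgval x).1.

Lemma deg_hwreath (x : hwreath) (i : 'I_N) : deg K (hbase x i) = deg hwreath x.
Proof. by have/hwreath_setP/(_ i) := subgP x. Qed.

Lemma hwreath_eq (x y : hwreath) :
  hbase x =1 hbase y -> hperm x = hperm y -> deg hwreath x = deg hwreath y ->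
  x = y.
Proof.
case: x y => [[[f s] a] hx] [[[g t] b] hy] efg est eab; apply: val_inj => /=.
by congr (Wreath _ _, _) => //; apply/ffunP.
Qed.

Lemma hbaseM (x y : hwreath) i :
  hbase (x * y) i = hbase x i * hbase y ((hperm x)^-1 i).
Proof. by rewrite /hbase /= ffunE. Qed.

Lemma hpermM (x y : hwreath) : hperm (x * y) = perm_comp (hperm x) (hperm y).
Proof. by []. Qed.

Lemma hbase1 i : hbase 1 i = 1.
Proof. by rewrite /hbase /= ffunE. Qed.

Lemma hperm1 : hperm 1 = 1.
Proof. by []. Qed.

Lemma hwreath_equideg : (0 < N)%N ->
  [set (sgval x).1 | x in [set: hwreath]] = equideg.
Proof.
move=> N_gt0; apply/setP => x; apply/imsetP/idP => [[y _ ->]|hx].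
  by have:= subgP y; rewrite inE => /andP[].
have hx' : (x, deg K (wreath_base x (Ordinal N_gt0))) \in hwreath_group.
  apply/hwreath_setP => i /=; move: hx; rewrite inE => /forallP/(_ i)/forallP.
  by move/(_ (Ordinal N_gt0))/eqP.
by exists (Subg hx'); rewrite ?inE.
Qed.

Lemma hwreath_val_inj : (0 < N)%N -> injective (fun x : hwreath => (sgval x).1).
Proof.
move=> N_gt0 x y exy; apply: hwreath_eq => [i||]; rewrite /hbase /hperm ?exy //.
by rewrite -!(deg_hwreath _ (Ordinal N_gt0)) /hbase exy.
Qed.

Lemma deg_hwreath_surj :
  deg K @* [set: K] = [set: Z2] -> deg hwreath @* [set: hwreath] = [set: Z2].
Proof.
move=> sK; apply/setP => e; rewrite [RHS]inE.
have /morphimP[a _ _ ->] : e \in deg K @* [set: K] by rewrite sK inE.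
have ha : (Wreath [ffun _ : 'I_N => a] 1, deg K a) \in hwreath_group.
  by apply/hwreath_setP => i; rewrite /= ffunE.
by apply/morphimP; exists (Subg ha); rewrite ?inE.
Qed.

End GradedWreath.

Section Cochains.
Variable R : realType.
Local Open Scope complex_scope.

Section Def.
Variables (n : nat) (K : gradedGroup).

Definition is_cochain (u : {ffun n.-tuple K -> R[i]}) : bool :=
  [forall t : n.-tuple K, `|u t|%R == 1%R] &&
  [forall t : n.-tuple K, (1 \in t) ==> (u t == 1%R)].

(* C^{n+pi}(BK).  The grading of K does not enter the group of cochains. *)
Record cochain := Cochain {
  cochain_fun :> {ffun n.-tuple K -> R[i]};
  cochainP : is_cochain cochain_fun
}.
HB.instance Definition _ := [isSub for cochain_fun].

Fact mkCochain_subproof (u : n.-tuple K -> R[i]) :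
  (forall t, `|u t|%R = 1%R) ->
  (forall t : n.-tuple K, 1 \in t -> u t = 1%R) ->
  is_cochain [ffun t => u t].
Proof.
move=> u1 uN; apply/andP; split; apply/forallP => t; rewrite ffunE ?u1 //.
by apply/implyP => /uN ->.
Qed.

Definition mkCochain (u : n.-tuple K -> R[i])
    (u1 : forall t, `|u t|%R = 1%R)
    (uN : forall t : n.-tuple K, 1 \in t -> u t = 1%R) : cochain :=
  Cochain (mkCochain_subproof u1 uN).

Lemma mkCochainE u u1 uN t : @mkCochain u u1 uN t = u t.
Proof. by rewrite /= ffunE. Qed.

Lemma cochain_norm (u : cochain) t : `|u t|%R = 1%R.
Proof. by case/andP: (cochainP u) => /forallP/(_ t)/eqP. Qed.

Lemma cochain_normalized (u : cochain) (t : n.-tuple K) :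
  1 \in t -> u t = 1%R.
Proof. by case/andP: (cochainP u) => _ /forallP/(_ t)/implyP h /h/eqP. Qed.

Lemma cochain_eq (u v : cochain) : (forall t, u t = v t) -> u = v.
Proof. by move=> e; apply: val_inj; apply/ffunP. Qed.

Fact cochain_one_norm (t : n.-tuple K) : `|1%R : R[i]|%R = 1%R.
Proof. exact: normr1. Qed.

Definition cochain_one : cochain :=
  mkCochain cochain_one_norm (fun t _ => erefl).

Section Mul.
Variables u v : cochain.

Fact cochain_mul_norm t : `|u t * v t|%R = 1%R.
Proof. by rewrite normrM !cochain_norm mulr1. Qed.
Fact cochain_mul_normalized (t : n.-tuple K) :
  1 \in t -> (u t * v t)%R = 1%R.
Proof. by move=> t1; rewrite !cochain_normalized ?mulr1. Qed.

Definition cochain_mul : cochain :=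
  mkCochain cochain_mul_norm cochain_mul_normalized.
End Mul.

End Def.

Section Pullback.
Variables (n : nat) (K L : gradedGroup) (f : gradedHom K L) (u : cochain n L).

Fact pullback_norm (t : n.-tuple K) : `|u (map_tuple f t)|%R = 1%R.
Proof. exact: cochain_norm. Qed.
Fact pullback_normalized (t : n.-tuple K) :
  1 \in t -> u (map_tuple f t) = 1%R.
Proof.
move=> t1; apply: cochain_normalized.
by apply/mapP; exists 1; rewrite ?graded_fun1.
Qed.

Definition pullback : cochain n K :=
  mkCochain pullback_norm pullback_normalized.
End Pullback.

Section ExternalProduct.
Variables (n : nat) (K L : gradedGroup) (u : cochain n K) (v : cochain n L).

Definition boxtimes_fun (t : n.-tuple (fibreProduct K L)) : R[i] :=
  (u (map_tuple (@fibre_fst K L) t) * v (map_tuple (@fibre_snd K L) t))%R.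

Fact boxtimes_norm t : `|boxtimes_fun t|%R = 1%R.
Proof. by rewrite normrM !cochain_norm mulr1. Qed.
Fact boxtimes_normalized (t : n.-tuple (fibreProduct K L)) :
  1 \in t -> boxtimes_fun t = 1%R.
Proof.
by move=> t1; rewrite /boxtimes_fun !cochain_normalized ?mulr1 //;
   apply/mapP; exists 1.
Qed.

Definition boxtimes : cochain n (fibreProduct K L) :=
  mkCochain boxtimes_norm boxtimes_normalized.
End ExternalProduct.

Section PowerOperation.
Variables (n : nat) (K : gradedGroup) (N : nat) (u : cochain n K).

(* With entries numbered from 0, [perm_before t i] is
   sigma_0 o ... o sigma_(i-1). *)
Definition perm_before (t : n.-tuple (hwreath K N)) (i : 'I_n) : {perm 'I_N} :=
  \big[@perm_comp _/1]_(k < n | (k < i)%N) hperm (tnth t k).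

Definition wp_entry (t : n.-tuple (hwreath K N)) (j : 'I_N) : n.-tuple K :=
  [tuple hbase (tnth t i) ((perm_before t i)^-1 j) | i < n].

(* For N = 0 this is an empty product, hence 1. *)
Definition wp_fun (t : n.-tuple (hwreath K N)) : R[i] :=
  (\prod_(j < N) u (wp_entry t j))%R.

Fact wp_norm t : `|wp_fun t|%R = 1%R.
Proof. by rewrite normr_prod big1 // => j _; rewrite cochain_norm. Qed.
Fact wp_normalized (t : n.-tuple (hwreath K N)) :
  1 \in t -> wp_fun t = 1%R.
Proof.
case/tnthP=> i ti; rewrite /wp_fun big1 // => j _; apply: cochain_normalized.
by apply/tnthP; exists i; rewrite tnth_mktuple -ti hbase1.
Qed.

Definition wp : cochain n (hwreath K N) := mkCochain wp_norm wp_normalized.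
End PowerOperation.

End Cochains.

Lemma pinv_eq (T : finType) (s : {perm T}) x y : s x = y -> s^-1 y = x.
Proof. by move<-; rewrite permK. Qed.

(* The canonical identification of the Real structure on G wr Sigma_1 with
   Ghat. *)
Section WreathOne.
Variable K : gradedGroup.

Definition hwreath1_fun (x : hwreath K 1) : K := hbase x ord0.

Fact hwreath1_funM : {morph hwreath1_fun : x y / x * y}.
Proof. by move=> x y; rewrite /hwreath1_fun hbaseM [X in hbase y X]ord1. Qed.
Fact hwreath1_fun_deg x : deg K (hwreath1_fun x) = deg (hwreath K 1) x.
Proof. exact: deg_hwreath. Qed.

Definition hwreath1 : gradedHom (hwreath K 1) K :=
  GradedHom hwreath1_funM hwreath1_fun_deg.

Lemma hwreath1_bij : bijective hwreath1.
Proof.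
have h a : (Wreath [ffun _ : 'I_1 => a] 1, deg K a) \in hwreath_group K 1.
  by apply/hwreath_setP => i; rewrite /= ffunE.
exists (fun a => Subg (h a)) => [x | a]; last first.
  by rewrite /= /hwreath1_fun /hbase /= ffunE.
apply: hwreath_eq => [i||].
- by rewrite {1}/hbase /= ffunE (ord1 i).
- by apply/permP => i; rewrite !ord1.
- exact: hwreath1_fun_deg.
Qed.
End WreathOne.

Section BlockSum.
Variables M N : nat.

Definition block_fun (s : {perm 'I_M}) (t : {perm 'I_N}) (i : 'I_(M + N)) :=
  match split i with
  | inl j => lshift N (s j)
  | inr k => rshift M (t k)
  end.

Lemma block_fun_inj s t : injective (block_fun s t).
Proof.
apply: (can_inj (g := block_fun s^-1 t^-1)) => i; rewrite /block_fun.
rewrite -[i in RHS]splitK; case: (split i) => j /=.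
  by rewrite (unsplitK (inl _)) permK.
by rewrite (unsplitK (inr _)) permK.
Qed.

Definition block_perm s t : {perm 'I_(M + N)} := perm (@block_fun_inj s t).

Lemma block_perm_l s t j : block_perm s t (lshift N j) = lshift N (s j).
Proof. by rewrite permE /block_fun (unsplitK (inl j)). Qed.
Lemma block_perm_r s t j : block_perm s t (rshift M j) = rshift M (t j).
Proof. by rewrite permE /block_fun (unsplitK (inr j)). Qed.

Variable K : gradedGroup.

Definition block_base (x : fibreProduct (hwreath K M) (hwreath K N)) :
    {ffun 'I_(M + N) -> K} :=
  [ffun i => match split i with
             | inl j => hbase (fibre_fst x) j
             | inr k => hbase (fibre_snd x) k
             end].

Definition block_val x : wreath K (M + N) * Z2 :=
  (Wreath (block_base x)
          (block_perm (hperm (fibre_fst x)) (hperm (fibre_snd x))),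
   deg _ x).

Fact block_valP x : block_val x \in hwreath_group K (M + N).
Proof.
apply/hwreath_setP => i; rewrite /= ffunE.
by case: (split i) => j; rewrite deg_hwreath // -(fibreP x).
Qed.

Definition iota_sum_fun x : hwreath K (M + N) := Subg (block_valP x).

Lemma iota_sum_base_l x j :
  hbase (iota_sum_fun x) (lshift N j) = hbase (fibre_fst x) j.
Proof. by rewrite {1}/hbase /= ffunE (unsplitK (inl j)). Qed.
Lemma iota_sum_base_r x j :
  hbase (iota_sum_fun x) (rshift M j) = hbase (fibre_snd x) j.
Proof. by rewrite {1}/hbase /= ffunE (unsplitK (inr j)). Qed.
Lemma iota_sum_perm x : hperm (iota_sum_fun x) =
  block_perm (hperm (fibre_fst x)) (hperm (fibre_snd x)).
Proof. by []. Qed.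

Fact iota_sum_funM : {morph iota_sum_fun : x y / x * y}.
Proof.
move=> x y; apply: hwreath_eq => [i||].
- rewrite hbaseM iota_sum_perm -(splitK i); case: (split i) => j /=.
  + rewrite (@pinv_eq _ _ (lshift N ((hperm (fibre_fst x))^-1 j))).
      by rewrite !iota_sum_base_l hbaseM.
    by rewrite block_perm_l permKV.
  + rewrite (@pinv_eq _ _ (rshift M ((hperm (fibre_snd x))^-1 j))).
      by rewrite !iota_sum_base_r hbaseM.
    by rewrite block_perm_r permKV.
- rewrite hpermM; apply/permP => i; rewrite perm_compE !iota_sum_perm -(splitK i).
  case: (split i) => j /=.
  + by rewrite !block_perm_l hpermM perm_compE.
  + by rewrite !block_perm_r hpermM perm_compE.
- by rewrite degM.
Qed.
Fact iota_sum_fun_deg x : deg _ (iota_sum_fun x) = deg _ x.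
Proof. by []. Qed.

Definition iota_sum :
    gradedHom (fibreProduct (hwreath K M) (hwreath K N)) (hwreath K (M + N)) :=
  GradedHom iota_sum_funM iota_sum_fun_deg.

End BlockSum.

Section WreathWreath.
Variables M N : nat.

(* The index j_k is [mxvec_index j k], i.e. the blocks are concatenated. *)
Definition mxvec_pair (i : 'I_(M * N)) : 'I_M * 'I_N :=
  enum_val (cast_ord (esym (mxvec_cast M N)) i).

Lemma mxvec_indexK j k : mxvec_pair (mxvec_index j k) = (j, k).
Proof. by rewrite /mxvec_pair cast_ordK enum_rankK. Qed.

Variable K : gradedGroup.

Definition nest_fun (x : hwreath (hwreath K N) M) (i : 'I_(M * N)) :
    'I_(M * N) :=
  let: (j, k) := mxvec_pair i in
  mxvec_index (hperm x j) (hperm (hbase x (hperm x j)) k).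

Lemma nest_fun_inj x : injective (nest_fun x).
Proof.
move=> a b; case/mxvec_indexP: a => j k; case/mxvec_indexP: b => j' k'.
rewrite /nest_fun !mxvec_indexK => /(congr1 mxvec_pair); rewrite !mxvec_indexK.
by case=> /perm_inj <- /perm_inj <-.
Qed.

Definition nest_perm x : {perm 'I_(M * N)} := perm (@nest_fun_inj x).

Lemma nest_permE x j k : nest_perm x (mxvec_index j k) =
  mxvec_index (hperm x j) (hperm (hbase x (hperm x j)) k).
Proof. by rewrite permE /nest_fun mxvec_indexK. Qed.

Definition nest_base (x : hwreath (hwreath K N) M) : {ffun 'I_(M * N) -> K} :=
  [ffun i => let: (j, k) := mxvec_pair i in hbase (hbase x j) k].

Definition nest_val x : wreath K (M * N) * Z2 :=
  (Wreath (nest_base x) (nest_perm x), deg _ x).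

Fact nest_valP x : nest_val x \in hwreath_group K (M * N).
Proof.
apply/hwreath_setP => i; rewrite /= ffunE.
by case: (mxvec_pair i) => j k; rewrite !deg_hwreath.
Qed.

Definition iota_wreath_fun x : hwreath K (M * N) := Subg (nest_valP x).

Lemma iota_wreath_base x j k :
  hbase (iota_wreath_fun x) (mxvec_index j k) = hbase (hbase x j) k.
Proof. by rewrite {1}/hbase /= ffunE mxvec_indexK. Qed.
Lemma iota_wreath_perm x : hperm (iota_wreath_fun x) = nest_perm x.
Proof. by []. Qed.

Fact iota_wreath_funM : {morph iota_wreath_fun : x y / x * y}.
Proof.
move=> x y; apply: hwreath_eq => [i||].
- rewrite hbaseM iota_wreath_perm; case/mxvec_indexP: i => j k.
  rewrite (@pinv_eq _ _ (mxvec_index ((hperm x)^-1 j)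
            ((hperm (hbase x j))^-1 k))); last by rewrite nest_permE !permKV.
  by rewrite !iota_wreath_base !hbaseM.
- rewrite hpermM !iota_wreath_perm; apply/permP => i.
  case/mxvec_indexP: i => j k; rewrite perm_compE !nest_permE.
  by rewrite hbaseM !hpermM !perm_compE permK.
- by rewrite degM.
Qed.
Fact iota_wreath_fun_deg x : deg _ (iota_wreath_fun x) = deg _ x.
Proof. by []. Qed.

(* iota((g_1;t_1),...,(g_M;t_M);s) = (g_1,...,g_M;(t;s)), where (t;s) sends
   j_k to s(j)_(t_(s(j))(k)). *)
Definition iota_wreath :
    gradedHom (hwreath (hwreath K N) M) (hwreath K (M * N)) :=
  GradedHom iota_wreath_funM iota_wreath_fun_deg.

End WreathWreath.

Section Diagonal.
Variable K : gradedGroup.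

Fact diag_valP (x : K) : (x, x) \in fibre_group K K.
Proof. by rewrite inE. Qed.

Definition iota_diag_fun (x : K) : fibreProduct K K := Subg (diag_valP x).

Fact iota_diag_funM : {morph iota_diag_fun : x y / x * y}.
Proof. by move=> x y; apply: val_inj. Qed.
Fact iota_diag_fun_deg x : deg _ (iota_diag_fun x) = deg _ x.
Proof. by []. Qed.

Definition iota_diag : gradedHom K (fibreProduct K K) :=
  GradedHom iota_diag_funM iota_diag_fun_deg.

End Diagonal.

(* Main.v *)
(** The permutation [sigma_0 ... sigma_(i-1)] occurring in [wp] is the
permutation part of the partial product [a_0 ... a_(i-1)] in the wreath
product. Since the inclusions are homomorphisms, they commute with partial
products, so both sides of each identity are products of the same values of
[alpha], indexed over ['I_M + 'I_N] in (ii) and ['I_M * 'I_N] in (iii). *)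

Require Import Defs.
From mathcomp Require Import all_boot all_order all_fingroup all_algebra.
From mathcomp Require Import reals complex.

Set Implicit Arguments.
Unset Strict Implicit.
Unset Printing Implicit Defensive.

Local Open Scope group_scope.

(** The filtered range matches [perm_before], so morphisms pass through it factor by factor; [m] is
    a natural number because inductions need [i.+1], which may equal [n]. *)
Definition partial_prod (T : finGroupType) n (t : n.-tuple T) (m : nat) : T :=
  \prod_(k < n | (k < m)%N) tnth t k.

Lemma partial_prod0 (T : finGroupType) n (t : n.-tuple T) :
  partial_prod t 0 = 1.
Proof. by rewrite /partial_prod big_pred0. Qed.

Lemma partial_prodS (T : finGroupType) n (t : n.-tuple T) (i : 'I_n) :
  partial_prod t i.+1 = partial_prod t i * tnth t i.
Proof.
(* Over ['I_m] the last factor can be split off; the default [1] of [nth] is never reached since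
   [m <= n]. *)
have pE m : (m <= n)%N -> partial_prod t m = \prod_(k < m) nth 1 t k.
  move=> le_mn; rewrite (big_ord_widen n (nth 1 t) le_mn).
  by apply: eq_bigr => k _; rewrite (tnth_nth 1).
by rewrite !pE ?(ltnW (ltn_ord i)) // big_ord_recr /= (tnth_nth 1).
Qed.

Lemma partial_prod_map (T U : finGroupType) (f : T -> U) n (t : n.-tuple T) m :
  {morph f : x y / x * y} ->
  partial_prod (map_tuple f t) m = f (partial_prod t m).
Proof.
move=> fM; have f1 : f 1 = 1 by apply: (mulgI (f 1)); rewrite -fM !mulg1.
by rewrite /partial_prod (big_morph f fM f1); apply: eq_bigr => k _; rewrite tnth_map.
Qed.

Lemma perm_beforeE (K : gradedGroup) N n (t : n.-tuple (hwreath K N)) (i : 'I_n) :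
  perm_before t i = hperm (partial_prod t i).
Proof.
by rewrite /perm_before /partial_prod (big_morph _ (@hpermM K N) (hperm1 K N)).
Qed.

(** By the wreath product law, the factor of index [m] contributes its entry at the preimage of [j]
    under the permutation accumulated so far, and this is entry [m] of [wp_entry t j]. In (iii) this
    identifies the inner permutations. *)
Lemma hbase_partial_prod (K : gradedGroup) N n (t : n.-tuple (hwreath K N)) m j :
  (m <= n)%N -> hbase (partial_prod t m) j = partial_prod (wp_entry t j) m.
Proof.
elim: m => [|m IHm] lt_mn; first by rewrite !partial_prod0 hbase1.
rewrite (partial_prodS t (Ordinal lt_mn)) (partial_prodS _ (Ordinal lt_mn)).
by rewrite hbaseM IHm ?(ltnW lt_mn) // tnth_mktuple perm_beforeE.
Qed.

Lemma wpE (R : realType) n (K : gradedGroup) N (u : cochain R n K)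
    (t : n.-tuple (hwreath K N)) :
  wp N u t = (\prod_(j < N) u (wp_entry t j))%R.
Proof. exact: mkCochainE. Qed.

Lemma pullbackE (R : realType) n (K L : gradedGroup) (f : gradedHom K L)
    (u : cochain R n L) (t : n.-tuple K) :
  pullback f u t = u (map_tuple f t).
Proof. exact: mkCochainE. Qed.

Lemma boxtimesE (R : realType) n (K L : gradedGroup) (u : cochain R n K)
    (v : cochain R n L) (t : n.-tuple (fibreProduct K L)) :
  boxtimes u v t = (u (map_tuple (@fibre_fst K L) t) *
                    v (map_tuple (@fibre_snd K L) t))%R.
Proof. exact: mkCochainE. Qed.

Lemma wp0 (R : realType) n (K : gradedGroup) (u : cochain R n K) :
  wp 0 u = cochain_one R n (hwreath K 0).
Proof. by apply: cochain_eq => t; rewrite wpE big_ord0 mkCochainE. Qed.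

Lemma wp1 (R : realType) n (K : gradedGroup) (u : cochain R n K) :
  wp 1 u = pullback (hwreath1 K) u.
Proof.
apply: cochain_eq => t; rewrite wpE pullbackE big_ord1; congr (u _).
(* The permuted index lies in ['I_1], hence equals [ord0]. *)
by apply: eq_from_tnth => i; rewrite tnth_mktuple tnth_map [_ ord0]ord1.
Qed.

Section BlockSumPower.
Variables (K : gradedGroup) (M N n : nat).
Variable t : n.-tuple (fibreProduct (hwreath K M) (hwreath K N)).

Lemma wp_entry_iota_sum_l j :
  wp_entry (map_tuple (iota_sum M N K) t) (lshift N j) =
  wp_entry (map_tuple (@fibre_fst _ _) t) j.
Proof.
apply: eq_from_tnth => i; rewrite !tnth_mktuple !tnth_map !perm_beforeE.
rewrite !partial_prod_map //; last exact: iota_sum_funM.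
rewrite iota_sum_perm -iota_sum_base_l; congr (hbase _ _).
(* The inverse of the block permutation is found by exhibiting a preimage, which stays in the left
   block. *)
by apply: pinv_eq; rewrite block_perm_l permKV.
Qed.

Lemma wp_entry_iota_sum_r j :
  wp_entry (map_tuple (iota_sum M N K) t) (rshift M j) =
  wp_entry (map_tuple (@fibre_snd _ _) t) j.
Proof.
apply: eq_from_tnth => i; rewrite !tnth_mktuple !tnth_map !perm_beforeE.
rewrite !partial_prod_map //; last exact: iota_sum_funM.
rewrite iota_sum_perm -iota_sum_base_r; congr (hbase _ _).
by apply: pinv_eq; rewrite block_perm_r permKV.
Qed.

End BlockSumPower.

Lemma wp_iota_sum (R : realType) n (K : gradedGroup) (u : cochain R n K) M N :
  boxtimes (wp M u) (wp N u) = pullback (iota_sum M N K) (wp (M + N) u).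
Proof.
apply: cochain_eq => t; rewrite boxtimesE pullbackE !wpE big_split_ord /=.
by congr (_ * _)%R; apply: eq_bigr => j _;
   rewrite ?wp_entry_iota_sum_l ?wp_entry_iota_sum_r.
Qed.

(** If the partial product has outer permutation [s] and inner permutations [t_j], the preimage of
    [j_k] has block [s^-1 j] and position [t_j^-1 k]. These are the shifts made by the outer and the
    inner [wp_entry]. *)
Lemma wp_entry_iota_wreath (K : gradedGroup) M N n
    (t : n.-tuple (hwreath (hwreath K N) M)) j k :
  wp_entry (map_tuple (iota_wreath M N K) t) (mxvec_index j k) =
  wp_entry (wp_entry t j) k.
Proof.
apply: eq_from_tnth => i; rewrite !tnth_mktuple tnth_map !perm_beforeE.
rewrite partial_prod_map; last exact: iota_wreath_funM.
rewrite iota_wreath_perm -hbase_partial_prod; last exact: ltnW.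
rewrite -iota_wreath_base; congr (hbase _ _).
by apply: pinv_eq; rewrite nest_permE !permKV.
Qed.

Lemma wp_iota_wreath (R : realType) n (K : gradedGroup) (u : cochain R n K) M N :
  wp M (wp N u) = pullback (iota_wreath M N K) (wp (M * N) u).
Proof.
apply: cochain_eq => t; rewrite pullbackE !wpE.
under eq_bigr do rewrite wpE.
(* Both sides become products over pairs [(j, k)], the right one through the bijection onto
   ['I_(M * N)]. *)
rewrite pair_bigA (reindex _ (curry_mxvec_bij M N)) /=.
by apply: eq_bigr => -[j k] _; rewrite /= wp_entry_iota_wreath.
Qed.

Lemma wp_mul (R : realType) n (K : gradedGroup) (u v : cochain R n K) N :
  wp N (cochain_mul u v) =
  pullback (iota_diag (hwreath K N)) (boxtimes (wp N u) (wp N v)).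
Proof.
apply: cochain_eq => t; rewrite pullbackE boxtimesE !wpE.
(* Taking any retraction [f] of the diagonal covers both projections at once. *)
have diagK (f : fibreProduct (hwreath K N) (hwreath K N) -> hwreath K N) :
    cancel (iota_diag (hwreath K N)) f ->
    map_tuple f (map_tuple (iota_diag (hwreath K N)) t) = t.
  by move=> fK; apply: eq_from_tnth => i; rewrite !tnth_map fK.
rewrite !diagK // -big_split /=.
by apply: eq_bigr => j _; rewrite ffunE.
Qed.

Theorem lemma5p2 (R : realType) (Ghat : gradedGroup) (G : {group Ghat})
    (hG : RealStructure Ghat G) (n : nat) (alpha beta : cochain R n Ghat) :
  (wp 0 alpha = cochain_one R n (hwreath Ghat 0) /\
   wp 1 alpha = pullback (hwreath1 Ghat) alpha) /\
  (forall M N : nat,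
     boxtimes (wp M alpha) (wp N alpha) =
     pullback (iota_sum M N Ghat) (wp (M + N)%N alpha)) /\
  (forall M N : nat,
     wp M (wp N alpha) = pullback (iota_wreath M N Ghat) (wp (M * N)%N alpha)) /\
  (forall N : nat,
     wp N (cochain_mul alpha beta) =
     pullback (iota_diag (hwreath Ghat N)) (boxtimes (wp N alpha) (wp N beta))).
Proof.
split; first by rewrite wp0 wp1.
split; first by move=> M N; apply: wp_iota_sum.
split=> [M N|N]; first exact: wp_iota_wreath.
exact: wp_mul.
Qed.
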